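(* Let $(X,d)$ be a metric space with $|X|\geq 3$ (not assumed complete), let $x^*\in X$, and let $T\colon X\to X$ be a continuous mapping. Suppose that: (i) $T$ does not possess periodic points of prime period $2$; (ii) $T$ is a generalized Kannan type mapping on $(M,d)$, where $M$ is an everywhere dense subset of $X$; that is, there exists $\lambda\in[0,\frac{2}{3})$ such that $$d(Tx,Ty)+d(Ty,Tz)+d(Tx,Tz)\leq \lambda\,(d(x,Tx)+d(y,Ty)+d(z,Tz))$$ for all three pairwise distinct points $x,y,z\in M$; (iii) there exists a point $x_0\in X$ such that the sequence of iterates $x_n=Tx_{n-1}$, $n=1,2,\ldots$, has a subsequence $x_{n_k}$ converging to $x^*$. Then $x^*$ is a fixed point of $T$, and the number of fixed points of $T$ is at most two.
   Context: A point $x\in X$ is a periodic point of prime period $2$ of $T$ if $T(T(x))=x$ and $Tx\neq x$. The set $M$ is not assumed to be invariant under $T$; condition (ii) only requires the displayed inequality for pairwise distinct points of $M$. *)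

(* Defs.v *)
From HB Require Import structures.
From mathcomp Require Import all_boot all_order all_algebra.
From mathcomp Require Import all_classical all_reals all_analysis.

Set Implicit Arguments.
Unset Strict Implicit.
Unset Printing Implicit Defensive.

Import Order.TTheory GRing.Theory Num.Theory.
Local Open Scope classical_set_scope.
Local Open Scope ring_scope.

Definition fixed_points (X : Type) (T : X -> X) : set X := [set x | T x = x].

Definition prime_period2 (X : Type) (T : X -> X) (x : X) : Prop :=
  T (T x) = x /\ T x <> x.

(* [M] need not be stable under [T]: the distances are those of [X]. *)
Definition generalized_Kannan_on (R : realType) (X : metricType R)
    (M : set X) (T : X -> X) : Prop :=
  exists2 lambda : R, 0 <= lambda < 2 / 3 &
    forall x y z : X, M x -> M y -> M z -> x <> y -> y <> z -> x <> z ->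
      mdist (T x) (T y) + mdist (T y) (T z) + mdist (T x) (T z) <=
      lambda * (mdist x (T x) + mdist y (T y) + mdist z (T z)).

(* Main.v *)
Require Import Defs.
From HB Require Import structures.
From mathcomp Require Import all_boot all_order all_algebra.
From mathcomp Require Import all_classical all_reals all_analysis.
From mathcomp Require Import lra.

Set Implicit Arguments.
Unset Strict Implicit.
Unset Printing Implicit Defensive.

Import Order.TTheory GRing.Theory Num.Theory.
Import numFieldNormedType.Exports.
Local Open Scope classical_set_scope.
Local Open Scope card_scope.
Local Open Scope ring_scope.

(** Continuity and density remove [M] from the problem: both sides of the
    generalized Kannan inequality are continuous in the three points, and
    distinctness is an open condition, so the inequality passes from [M] to
    the whole space ([generalized_Kannan_dense]).  Three distinct fixed points
    would then have a positive perimeter bounded by 0, hence the bound by two.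

    For the fixed point, put [d n := mdist (x n) (x n.+1)] along the orbit.
    When [x n], [x n.+1], [x n.+2] are distinct, the inequality gives
    [d n.+1 + d n.+2 + mdist (x n.+1) (x n.+3)
       <= lambda * (d n + d n.+1 + d n.+2)],
    and the left-hand side is at least [2 * d n.+2] by the triangle inequality.
    Solving for [d n.+2] yields [d n.+2 <= c * (d n + d n.+1)] with
    [c = lambda / (2 - lambda)], and [c < 1 / 2] is exactly [lambda < 2 / 3].
    Without points of prime period 2, the three points can fail to be distinct
    only if the orbit has become stationary, where [d n.+2 = 0]
    ([generalized_Kannan_step]).  Such a recursion forces [d n --> 0]
    ([two_step_contraction_cvg0]).

    Along a subsequence tending to [xstar] the distances [d (nk k)] then tend
    both to 0 and, by continuity, to [mdist xstar (T xstar)]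
    ([asymptotically_regular_cvg_fixed]). *)

Lemma cvg_mdist (R : realType) (X : metricType R) (I : Type)
    (F : set_system I) (FF : Filter F) (f g : I -> X) (a b : X) :
  f @ F --> a -> g @ F --> b ->
  mdist (f i) (g i) @[i --> F] --> (mdist a b : R).
Proof.
move=> fa gb; apply/cvgrPdist_le => e e0.
have e20 : 0 < e / 2 by rewrite divr_gt0.
have fe : \forall i \near F, mdist a (f i) <= e / 2.
  exact: metricType_numDomainType.cvgr_dist_le fa _ e20.
have ge : \forall i \near F, mdist b (g i) <= e / 2.
  exact: metricType_numDomainType.cvgr_dist_le gb _ e20.
near=> i.
have fei : mdist a (f i) <= e / 2 by near: i.
have gei : mdist b (g i) <= e / 2 by near: i.
(* The distance varies by at most mdist a (f i) + mdist b (g i): both bounds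
   go around the quadrilateral a, f i, g i, b. *)
have := metric_triangle a (f i) b.
have := metric_triangle (f i) (g i) b.
have := metric_triangle (f i) a (g i).
have := metric_triangle a b (g i).
have := metric_sym (f i) a; have := metric_sym (g i) b.
rewrite ler_norml; lra.
Unshelve. all: by end_near. Qed.

Lemma near_neq (R : realType) (X : metricType R) (I : Type)
    (F : set_system I) (FF : Filter F) (f g : I -> X) (a b : X) :
  f @ F --> a -> g @ F --> b -> a <> b -> \forall i \near F, f i <> g i.
Proof.
move=> fa gb /eqP; rewrite -mdist_gt0 => ab.
have : \forall i \near F, 0 < mdist (f i) (g i).
  exact: (cvgr_gt _ (cvg_mdist FF fa gb)).
by apply: filterS => i; rewrite mdist_gt0 => /eqP.
Qed.

Lemma dense_proper_within (X : topologicalType) (M : set X) (x : X) :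
  dense M -> ProperFilter (within M (nbhs x)).
Proof.
move=> dM; apply: within_nbhs_proper => B xB.
have [y [/interior_subset By My]] := dM B° (ex_intro _ x xB) (open_interior B).
by exists y.
Qed.

(** The three points are approximated independently, along the product of the
    traces on [M] of their neighbourhood filters; this product is proper because
    [M] is dense.  Along it the approximating points are eventually distinct, so
    the inequality on [M] applies to them and survives in the limit.  An isolated
    point of the space needs no separate treatment: it lies in [M]. *)
Lemma generalized_Kannan_dense (R : realType) (X : metricType R)
    (M : set X) (T : X -> X) :
  continuous T -> dense M -> generalized_Kannan_on M T ->
  generalized_Kannan_on setT T.
Proof.
move=> cT dM [lambda l23 TK]; exists lambda => // x y z _ _ _ xy yz xz.
pose G (a : X) : set_system X := within M (nbhs a).
have PG a : ProperFilter (G a) by exact: dense_proper_within.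
pose F := filter_prod (filter_prod (G x) (G y)) (G z).
have PF : ProperFilter F by do 2![apply: filter_prod_proper => //].
have Gid a : id @ G a --> a by exact: cvg_within.
have cx : p.1.1 @[p --> F] --> x.
  exact: (cvg_comp _ _ (cvg_comp _ _ cvg_fst cvg_fst) (Gid x)).
have cy : p.1.2 @[p --> F] --> y.
  exact: (cvg_comp _ _ (cvg_comp _ _ cvg_fst cvg_snd) (Gid y)).
have cz : p.2 @[p --> F] --> z by exact: (cvg_comp _ _ cvg_snd (Gid z)).
have cTx : T p.1.1 @[p --> F] --> T x.
  exact: (continuous_cvg _ (cT x) cx).
have cTy : T p.1.2 @[p --> F] --> T y.
  exact: (continuous_cvg _ (cT y) cy).
have cTz : T p.2 @[p --> F] --> T z.
  exact: (continuous_cvg _ (cT z) cz).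
have MF : \forall p \near F, [/\ M p.1.1, M p.1.2 & M p.2].
  have MG a : \forall b \near G a, M b by exact: withinT.
  near=> p; split; near: p.
  - exact: (cvg_comp _ _ cvg_fst cvg_fst) (MG x).
  - exact: (cvg_comp _ _ cvg_fst cvg_snd) (MG y).
  - exact: cvg_snd (MG z).
have xyF := near_neq PF cx cy xy.
have yzF := near_neq PF cy cz yz.
have xzF := near_neq PF cx cz xz.
pose L x y z : R := mdist (T x) (T y) + mdist (T y) (T z) + mdist (T x) (T z).
pose K x y z : R := lambda * (mdist x (T x) + mdist y (T y) + mdist z (T z)).
have cL : L p.1.1 p.1.2 p.2 @[p --> F] --> L x y z.
  by apply: cvgD; [apply: cvgD|]; exact: cvg_mdist.
have cK : K p.1.1 p.1.2 p.2 @[p --> F] --> K x y z.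
  by apply: cvgMr; apply: cvgD; [apply: cvgD|]; exact: cvg_mdist.
apply: (ler_cvg_to cL cK).
near=> p.
have [Mx My Mz] : [/\ M p.1.1, M p.1.2 & M p.2] by near: p.
by apply: TK => //; near: p.
Unshelve. all: by end_near. Qed.

Lemma card_le_I2 (X : Type) (A : set X) :
  (forall x y z, A x -> A y -> A z -> x <> y -> y <> z -> x <> z -> False) ->
  A #<= `I_2.
Proof.
move=> A3.
have [->|/set0P[a Aa]] := eqVneq A set0; first exact: card_ge0.
have [b bP] : exists b, A `<=` [set a; b].
  have [[b [Ab ab]]|nb] := pselect (exists b, A b /\ a <> b).
    exists b => c Ac /=; apply: contrapT => /not_orP[ca cb].
    by apply: (A3 a b c) => // /esym.
  exists a => c Ac /=; left; apply: contrapT => ca.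
  by apply: nb; exists c; split => // /esym.
apply: card_le_trans (card_image_le (fun i => if i == 0%N then a else b) _).
apply: subset_card_le => c /bP[->|->] /=; first by exists 0%N.
by exists 1%N.
Qed.

Lemma fixed_points_card_le2 (R : realType) (X : metricType R) (T : X -> X) :
  generalized_Kannan_on setT T -> fixed_points T #<= `I_2.
Proof.
move=> [lambda _ TK]; apply: card_le_I2 => x y z Tx Ty Tz xy yz xz.
have := TK x y z I I I xy yz xz; rewrite Tx Ty Tz !mdistxx !addr0 mulr0.
have /eqP := xy; rewrite -mdist_gt0.
have := mdist_ge0 y z; have := mdist_ge0 x z; lra.
Qed.

(** The perimeter inequality turned into a two-step recursion for the
    displacements [mdist x (T x)] along an orbit.  The constant is
    [lambda / (2 - lambda)].  The bound is stated for every [x], so that orbits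
    which reach a fixed point are covered along with those which do not. *)
Lemma generalized_Kannan_step (R : realType) (X : metricType R) (T : X -> X) :
  (~ exists x, prime_period2 T x) -> generalized_Kannan_on setT T ->
  exists2 c : R, 0 <= c < 1 / 2 & forall x,
    mdist (T (T x)) (T (T (T x))) <=
    c * (mdist x (T x) + mdist (T x) (T (T x))).
Proof.
move=> np [lambda /andP[l0 l23] TK].
have l2 : 0 < 2 - lambda by lra.
exists (lambda / (2 - lambda)).
  by rewrite divr_ge0 ?(ltW l2)//= ltr_pdivrMr//; lra.
move=> x; have d0 := mdist_ge0 x (T x); have d1 := mdist_ge0 (T x) (T (T x)).
(* A coincidence among x, T x, T (T x) forces T (T x) to be fixed, and then
   the left-hand side vanishes. *)
have [Te|Tne] := eqVneq (T (T x)) (T (T (T x))).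
  rewrite -Te mdistxx mulr_ge0 ?addr_ge0// divr_ge0// ltW//.
have xTx : x <> T x by move=> e; move/eqP: Tne; apply; rewrite -!e.
have TxTTx : T x <> T (T x) by move=> e; move/eqP: Tne; apply; rewrite -!e.
have xTTx : x <> T (T x).
  by move=> e; apply: np; exists x; split; [rewrite -e|move/esym].
have := TK _ _ _ I I I xTx TxTTx xTTx.
have := metric_triangle (T (T x)) (T x) (T (T (T x))).
rewrite (metric_sym (T (T x)) (T x)) => tri K.
rewrite mulrAC ler_pdivlMr//; nra.
Qed.

(** The weighted sum [u n / 2 + u n.+1] decays geometrically, at rate
    [c + 1 / 2 < 1]: its next value is at most
    [c * u n + (c + 1 / 2) * u n.+1], and [c <= (c + 1 / 2) / 2]. *)
Lemma two_step_contraction_cvg0 (R : realType) (c : R) (u : nat -> R) :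
  0 <= c < 1 / 2 -> (forall n, 0 <= u n) ->
  (forall n, u n.+2 <= c * (u n + u n.+1)) -> u @ \oo --> 0.
Proof.
move=> /andP[c0 c2] u0 us.
pose q := c + 1 / 2; pose e n := u n / 2 + u n.+1.
have ee n : e n <= e 0%N * q ^+ n.
  elim: n => [|n IH]; first by rewrite expr0 mulr1.
  have /le_trans : e n.+1 <= q * e n.
    by have := us n; have := u0 n; have := u0 n.+1; rewrite /e /q; nra.
  apply; rewrite exprS mulrCA ler_pM2l// /q; lra.
rewrite -cvg_shiftS.
apply: (@squeeze_cvgr _ _ _ _ (fun=> 0) (fun n => e 0%N * q ^+ n)).
- near=> n; rewrite u0 /=; apply: le_trans (ee n).
  by have := u0 n; rewrite /e; lra.
- exact: cvg_cst.
- rewrite -[X in _ --> X](mulr0 (e 0%N)); apply: cvgMr.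
  by apply: cvg_expr; rewrite ger0_norm /q; lra.
Unshelve. all: by end_near. Qed.

(** Applied to a convergent subsequence of an orbit: [u n.+1] need not be
    [T (u n)], only the displacements of the terms have to vanish. *)
Lemma asymptotically_regular_cvg_fixed (R : realType) (X : metricType R)
    (T : X -> X) (u : nat -> X) (a : X) :
  continuous T -> u @ \oo --> a ->
  mdist (u n) (T (u n)) @[n --> \oo] --> (0 : R) -> T a = a.
Proof.
move=> cT ua du; apply/esym/mdist_positivity.
have dTa : mdist (u n) (T (u n)) @[n --> \oo] --> mdist a (T a).
  exact: (cvg_mdist _ ua (continuous_cvg _ (cT a) ua)).
exact: (cvg_unique (@norm_hausdorff R R^o) dTa du).
Qed.

Lemma increasing_seq_cvgny (nk : nat -> nat) :
  increasing_seq nk -> nk @ \oo --> \oo.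
Proof.
move=> nkE; apply/cvgnyPge => N; near=> k.
have : (N <= k)%N by near: k; exact: nbhs_infty_ge.
move=> /leq_trans; apply.
elim: (k) => // m IH; apply: leq_ltn_trans IH _.
by rewrite (leqW_mono nkE).
Unshelve. all: by end_near. Qed.

Theorem theorem6p2 (R : realType) (X : metricType R)
    (cardX : `I_3 #<= [set: X])
    (xstar : X) (T : X -> X) (T_cont : continuous T)
    (no_period2 : ~ exists x : X, prime_period2 T x)
    (M : set X) (M_dense : dense M) (T_Kannan : generalized_Kannan_on M T)
    (subseq_cvg : exists (x0 : X) (nk : nat -> nat),
      increasing_seq nk /\ (iter (nk k) T x0 @[k --> \oo] --> xstar)) :
  fixed_points T xstar /\ fixed_points T #<= `I_2.
Proof.
have TK := generalized_Kannan_dense T_cont M_dense T_Kannan.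
split; last exact: fixed_points_card_le2.
have [x0 [nk [nkE nkx]]] := subseq_cvg.
have [c c2 Tc] := generalized_Kannan_step no_period2 TK.
apply: (asymptotically_regular_cvg_fixed T_cont nkx).
have d0 : mdist (iter n T x0) (T (iter n T x0)) @[n --> \oo] --> (0 : R).
  apply: (two_step_contraction_cvg0 c2) => n; first exact: mdist_ge0.
  exact: Tc (iter n T x0).
exact: cvg_comp (increasing_seq_cvgny nkE) d0.
Qed.
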